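(* Let $k\in\{1,2,3\}$ and let $n\ge k$ be an integer. There exists a $k$-balanced permutation in $\mathbb{S}_n$ if and only if $r!$ divides $\binom{n}{r}$ for every integer $1\le r\le k$.
   Context: $\mathbb{S}_n$ is the set of permutations of $[n]=\{1,\dots,n\}$. For $\pi\in\mathbb{S}_n$, $\tau\in\mathbb{S}_k$ with $k\le n$, and $S=\{s_1<\dots<s_k\}\subseteq[n]$, write $\pi(S)\cong\tau$ if for all $i,j\in[k]$: $\pi(s_i)<\pi(s_j)\iff\tau(i)<\tau(j)$. Let $\#\tau(\pi)$ be the number of $k$-element sets $S\subseteq[n]$ with $\pi(S)\cong\tau$. A permutation $\pi\in\mathbb{S}_n$ is $k$-balanced ($1\le k\le n$) if $\#\tau(\pi)=\binom{n}{k}/k!$ for every $\tau\in\mathbb{S}_k$. (An integer $n$ satisfying the divisibility conditions in the claim is called admissible.) *)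

(* Defs.v *)
From mathcomp Require Import all_boot all_order all_algebra all_fingroup.
Set Implicit Arguments.
Unset Strict Implicit.
Unset Printing Implicit Defensive.

(* The set [n] is represented by 'I_n = {0, ..., n-1}. *)

(* [enum S] lists a set S of ordinals in increasing order. *)
Lemma enum_set_ord_sorted (n : nat) (S : {set 'I_n}) :
  sorted ltn [seq val x | x <- enum S].
Proof.
rewrite sorted_map {1}/enum_mem; apply: sorted_filter.
  by move=> x y z /=; apply: ltn_trans.
by rewrite -enumT -sorted_map val_enum_ord iota_ltn_sorted.
Qed.

(* pi(s_1), ..., pi(s_k) for S = {s_1 < ... < s_k}. *)
Definition values_on (n : nat) (pi : 'S_n) (S : {set 'I_n}) : seq nat :=
  [seq val (pi x) | x <- enum S].

(* The relation pi(S) ~ tau. The default value 0 of [nth] is never reached,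
   since the sequence has size #|S| = k. *)
Definition is_occurrence (n k : nat) (pi : 'S_n) (tau : 'S_k)
    (S : {set 'I_n}) : bool :=
  (#|S| == k) &&
  [forall i : 'I_k, forall j : 'I_k,
     (nth 0 (values_on pi S) i < nth 0 (values_on pi S) j)
       == (tau i < tau j)].

Definition pattern_count (n k : nat) (tau : 'S_k) (pi : 'S_n) : nat :=
  #|[set S : {set 'I_n} | is_occurrence pi tau S]|.

(* Stated over the rationals, so that the division by k! is exact. *)
Definition balanced (n k : nat) (pi : 'S_n) : Prop :=
  forall tau : 'S_k,
    ((pattern_count tau pi)%:R = 'C(n, k)%:R / k`!%:R :> rat)%R.
Arguments balanced [n] k pi.

(* Main.v *)
Require Import Defs.
From mathcomp Require Import all_boot all_order all_algebra all_fingroup.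
From mathcomp Require Import zify ring.
Import GRing.Theory Num.Theory.

(** Necessity is double counting. If every pattern of length k occurs equally
    often, then k! divides binomial(n, k). For k = 3 the condition at r = 2
    follows as well: the signed count of ordered minus inverted pairs vanishes on
    average over the six patterns, and each pair of positions lies in n - 2
    triples, so pi has as many inversions as non-inversions ([balanced3_even]).

    For sufficiency take permutations whose graph is invariant under the
    rotation of the square by a quarter turn; this says that pi o pi is the
    reversal ([rotational]). Rotating an occurrence of tau gives an occurrence
    of the rotated pattern ([pattern_count_rot]), so the two patterns of length
    2 are equally frequent, and so are 123 and 321, and so are the other four
    patterns of length 3. For k = 3 one equation remains, the proportion of
    monotone triples. As in Goodman's count of monochromatic triangles, it can
    be read off from the points taken one at a time: if s(u, v) is 1 or -1
    according to whether the pair u, v is in order or inverted, then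
    [energy pi], the sum over u of (sum over v of s(u, v))^2, is an affine
    function of the number of monotone triples, and pi is 3-balanced as soon as
    9 * energy pi = n (n - 1) (n + 7) ([rotational_balanced3]).

    The divisibility conditions leave n = 0, 1, 9, 20, 28, 29 modulo 36. All
    these n are reached from twelve small permutations by wrapping a rotational
    permutation of size n in a fixed rotational ring of 72 points ([nest]). Of
    these, 24 corner points see the whole inner permutation in one quadrant and
    48 side points, next to an axis of the square, see it cut in halves. The
    influence of the ring on an inner point cancels by symmetry, while the inner
    permutation adds n or -n to the row sum of a corner point and, up to 1,
    nothing to that of a side point. Hence the energy grows by a quadratic
    polynomial in n; 24 corners give its leading coefficient the right value,
    and the ring is chosen so that the other coefficients are right too
    ([tuned_step]). *)

Set Implicit Arguments.
Unset Strict Implicit.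
Unset Printing Implicit Defensive.

(** * Occurrences of patterns *)

Lemma lt_homo_mono (k : nat) (v : 'I_k -> nat) :
  (forall i j : 'I_k, i < j -> v i < v j) ->
  forall i j : 'I_k, (v i < v j) = (i < j).
Proof.
move=> v_homo i j; case: (ltngtP i j) => [/v_homo->//|/v_homo/ltnW|/val_inj->].
  by rewrite leqNgt => /negbTE.
by rewrite ltnn.
Qed.

(** Replaces the sorted list of the elements of S by an increasing
    parametrization x of S; this is the form in which an occurrence can be
    transported along a map. *)
Lemma occurrenceP (n k : nat) (pi : 'S_n) (tau : 'S_k) (S : {set 'I_n}) :
  reflect (exists2 x : 'I_k -> 'I_n, S = [set x i | i : 'I_k] &
             forall i j, (x i < x j) = (i < j) /\
                         (pi (x i) < pi (x j)) = (tau i < tau j))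
          (is_occurrence pi tau S).
Proof.
apply: (iffP andP) => [[/eqP cardS /forallP occ]|[x -> x_mono]].
  pose x i := enum_val (cast_ord (esym cardS) i).
  have xE y i : x i = nth y (enum S) i by rewrite /x (enum_val_nth y).
  have val_x i : val (x i) = nth 0 [seq val y | y <- enum S] i.
    by rewrite (nth_map (x i)) -?xE // -cardE cardS.
  exists x; last (move=> i j; split).
  - apply/setP => y; apply/idP/imsetP => [Sy|[i _ ->]]; last exact: enum_valP.
    exists (cast_ord cardS (enum_rank_in Sy y)) => //.
    by rewrite /x cast_ordK enum_rankK_in.
  - apply: (@lt_homo_mono _ (fun i => x i)) => {}i {}j ltij; rewrite !val_x.
    apply: (sorted_ltn_nth ltn_trans 0 (enum_set_ord_sorted S)) => //;
      by rewrite inE size_map -cardE cardS.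
  - have /forallP/(_ j)/eqP <- := occ i.
    by rewrite /values_on !(nth_map (x i)) -?xE // -cardE cardS.
have x_inj : injective x.
  move=> i j eq_x; apply: val_inj; case: (ltngtP i j) => // lt.
    by move: (x_mono i j) => [/esym]; rewrite lt eq_x ltnn.
  by move: (x_mono j i) => [/esym]; rewrite lt eq_x ltnn.
rewrite card_imset // card_ord eqxx; split=> //.
have enumE : enum [set x i | i : 'I_k] = [seq x i | i <- enum 'I_k].
  apply: (inj_map val_inj).
  apply: (irr_sorted_eq ltn_trans ltnn (enum_set_ord_sorted _)).
    rewrite -map_comp sorted_map.
    apply: (@sub_sorted _ (relpre val ltn)) => [i j /=|]; first by case: (x_mono i j) => ->.
    by rewrite -sorted_map val_enum_ord iota_ltn_sorted.
  move=> y; apply/mapP/mapP => -[z zP ->]; exists z => //.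
    move: zP; rewrite mem_enum => /imsetP[i _ ->].
    by apply: map_f; rewrite mem_enum.
  by move/mapP: zP => [i _ ->]; rewrite mem_enum imset_f.
apply/forallP => i; apply/forallP => j; apply/eqP.
rewrite /values_on enumE -map_comp !(nth_map i) -?enumT ?size_enum_ord // !nth_ord_enum /=.
by case: (x_mono i j).
Qed.

(** The standardization of a sequence of distinct values. *)
Lemma rank_perm (k : nat) (v : 'I_k -> nat) : injective v ->
  exists tau : 'S_k, forall i j, (tau i < tau j) = (v i < v j).
Proof.
move=> v_inj; pose r i := #|[set j | v j < v i]|.
have r_homo i j : v i < v j -> r i < r j.
  move=> ltv; apply/proper_card/properP; split.
    by apply/subsetP => l; rewrite !inE => /ltn_trans; apply.
  by exists i; rewrite !inE ?ltnn.
have r_lt i : r i < k.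
  rewrite -[X in _ < X]card_ord -cardsT; apply/proper_card/properP.
  by split; [exact: subsetT | exists i; rewrite !inE ?ltnn].
have r_mono i j : (r i < r j) = (v i < v j).
  case: (ltngtP (v i) (v j)) => [/r_homo->//|/r_homo/ltnW|/v_inj->].
    by rewrite leqNgt => /negbTE.
  by rewrite ltnn.
have r_inj : injective (fun i => Ordinal (r_lt i)).
  move=> i j [eq_r]; apply: v_inj.
  by case: (ltngtP (v i) (v j)) => // /r_homo; rewrite eq_r ltnn.
by exists (perm r_inj) => i j; rewrite !permE /= r_mono.
Qed.

(** A permutation is recovered from its order relation, as the image of i is
    the number of elements with a smaller image. *)
Lemma perm_eq_of_order (k : nat) (s t : 'S_k) :
  (forall i j, (s i < s j) = (t i < t j)) -> s = t.
Proof.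
have rankE (u : 'S_k) i : #|[set j | u j < u i]| = u i.
  rewrite -(card_imset _ (@perm_inj _ u)).
  have -> : [set u j | j in [set j | u j < u i]] = [set j : 'I_k | j < u i].
    apply/setP => j; rewrite inE; apply/imsetP/idP => [[l]|ltj].
      by rewrite inE => + ->.
    by exists (u^-1 j)%g; rewrite ?inE permKV.
  rewrite cardsE -sum1_card (eq_bigl (fun j : 'I_k => j < u i)) //.
  by rewrite (big_ord_narrow (ltnW (ltn_ord (u i)))) sum1_card card_ord.
move=> eq_st; apply/permP => i; apply: val_inj; rewrite /= -(rankE s) -(rankE t).
by apply: eq_card => j; rewrite !inE eq_st.
Qed.

(** Every set of size k is an occurrence of exactly one pattern, so a sum over
    the sets of size k can be grouped by pattern. *)
Lemma sum_by_pattern (n k : nat) (pi : 'S_n) (V : nmodType)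
    (F : {set 'I_n} -> V) (f : 'S_k -> V) :
  (forall tau S, is_occurrence pi tau S -> F S = f tau) ->
  (\sum_(S : {set 'I_n} | #|S| == k) F S =
     \sum_(tau : 'S_k) f tau *+ pattern_count tau pi)%R.
Proof.
move=> FE.
have occ1 (S : {set 'I_n}) : #|S| == k -> exists2 tau : 'S_k,
    is_occurrence pi tau S & forall t, is_occurrence pi t S = (t == tau).
  move=> /eqP cardS; have szS : size (values_on pi S) = k.
    by rewrite size_map -cardE.
  have uS : uniq (values_on pi S).
    by rewrite map_inj_uniq ?enum_uniq // => i j /val_inj /perm_inj.
  have [i j /eqP|tau tauE] := @rank_perm k (fun i => nth 0 (values_on pi S) i).
    by rewrite nth_uniq ?szS // => /eqP /val_inj.
  have occ_tau : is_occurrence pi tau S.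
    rewrite /is_occurrence cardS eqxx.
    by apply/forallP => i; apply/forallP => j; rewrite tauE.
  exists tau => // t; apply/idP/eqP => [|-> //].
  case/andP => _ /forallP occ_t; apply: perm_eq_of_order => i j.
  by have /forallP/(_ j)/eqP <- := occ_t i; rewrite tauE.
transitivity (\sum_(S : {set 'I_n} | #|S| == k)
                \sum_(tau : 'S_k | is_occurrence pi tau S) f tau)%R.
  apply: eq_bigr => S /occ1[tau occ_tau occE].
  by rewrite (eq_bigl (pred1 tau)) // big_pred1_eq; apply: FE.
rewrite (exchange_big_dep xpredT) //=; apply: eq_bigr => tau _.
rewrite sumr_const; congr (_ *+ _)%R; apply: eq_card => S.
by rewrite !inE unfold_in; apply/andb_idl => /andP[].
Qed.

Lemma sum_pattern_count (n k : nat) (pi : 'S_n) :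
  \sum_(tau : 'S_k) pattern_count tau pi = 'C(n, k).
Proof.
have := @sum_by_pattern n k pi nat (fun=> 1%N) (fun=> 1%N) (fun _ _ _ => erefl).
rewrite sum1_card => sumE.
rewrite -[in RHS](card_ord n) -card_draws cardsE sumE.
by apply: eq_bigr => tau _; rewrite natn.
Qed.

(** Clears the denominator, which is what links balance to divisibility. *)
Lemma balancedP (n k : nat) (pi : 'S_n) :
  balanced k pi <-> forall tau : 'S_k, pattern_count tau pi * k`! = 'C(n, k).
Proof.
have k_neq0 : (k`!%:R != 0 :> rat)%R by rewrite pnatr_eq0 -lt0n fact_gt0.
split=> bal tau.
  apply/eqP; rewrite -(eqr_nat rat) natrM bal divfK //.
by rewrite -(bal tau) natrM mulfK.
Qed.

(** * Invariance under a quarter turn *)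

(** The quarter turn sends the point (i, pi i) to (pi i, n - 1 - i). It maps the
    graph of pi to itself exactly when pi (pi i) = n - 1 - i. *)
Definition rotational (n : nat) (pi : 'S_n) := forall i, pi (pi i) = rev_ord i.

Definition rev_perm (n : nat) : 'S_n := perm (@rev_ord_inj n).

Lemma rev_permK (n : nat) : (rev_perm n * rev_perm n = 1)%g.
Proof. by apply/permP => i; rewrite permM !permE rev_ordK. Qed.

Lemma ltn_rev_ord (n : nat) (i j : 'I_n) : (rev_ord i < rev_ord j) = (j < i).
Proof. by have := ltn_ord i; have := ltn_ord j; rewrite /=; lia. Qed.

(** If S is an occurrence of tau, then pi S is an occurrence of the rotated
    pattern: the element of pi S of rank tau i is pi (s_i), which pi sends to the
    reverse of s_i. As S and pi S determine each other, the count can only grow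
    under the rotation of tau, and four rotations bring tau back. *)
Lemma pattern_count_rot (n k : nat) (pi : 'S_n) (tau : 'S_k) : rotational pi ->
  pattern_count (tau^-1 * rev_perm k)%g pi = pattern_count tau pi.
Proof.
move=> rot_pi; pose rho t : 'S_k := (t^-1 * rev_perm k)%g.
have leq_rho t : pattern_count t pi <= pattern_count (rho t) pi.
  rewrite /pattern_count -(card_imset _ (imset_inj (@perm_inj _ pi))).
  apply/subset_leq_card/subsetP => T /imsetP[S]; rewrite !inE.
  case/occurrenceP => x -> x_mono ->; apply/occurrenceP.
  pose z i := pi (x ((t^-1)%g i)); exists z; last move=> i j.
    apply/setP => y; apply/imsetP/imsetP => [[_ /imsetP[i _ ->] ->]|[i _ ->]].
      by exists (t i); rewrite // /z permK.
    by exists (x (t^-1 i)%g) => //; apply: imset_f.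
  case: (x_mono (t^-1 i) (t^-1 j))%g => ltx ltpi.
  rewrite /z ltpi !permKV !rot_pi ltn_rev_ord; split=> //.
  rewrite !permM !(permE (@rev_ord_inj k)) ltn_rev_ord.
  by case: (x_mono (t^-1 j) (t^-1 i))%g.
have rhoK : rho (rho (rho (rho tau))) = tau.
  have revV : ((rev_perm k)^-1 = rev_perm k)%g.
    by apply/eqP; rewrite eq_invg_mul rev_permK.
  by rewrite /rho !invMg !revV !invgK !mulgA rev_permK mul1g -!mulgA rev_permK mulg1.
apply/eqP; rewrite eqn_leq leq_rho andbT -[in leqRHS]rhoK.
by do 2!apply: (leq_trans _ (leq_rho _)).
Qed.

(** * The energy of a permutation *)

Local Open Scope ring_scope.

Definition cmp (a b : nat) : int :=
  if (a < b)%N then 1 else if (b < a)%N then -1 else 0.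

(** The sign of a pair: 1 in order, -1 for an inversion, 0 on the diagonal. *)
Definition cross (n : nat) (pi : 'S_n) (u v : 'I_n) : int :=
  cmp u v * cmp (pi u) (pi v).

Definition energy (n : nat) (pi : 'S_n) : int :=
  \sum_u (\sum_v cross pi u v) ^+ 2.

Lemma cmpC (a b : nat) : cmp a b = - cmp b a.
Proof. by rewrite /cmp; case: (ltngtP a b). Qed.

Lemma cmp_eq (a b c d : nat) :
  (a < b)%N = (c < d)%N -> (b < a)%N = (d < c)%N -> cmp a b = cmp c d.
Proof. by rewrite /cmp => -> ->. Qed.

Lemma crossC (n : nat) (pi : 'S_n) u v : cross pi u v = cross pi v u.
Proof. by rewrite /cross cmpC [cmp (pi u) _]cmpC mulrNN. Qed.

Lemma crossxx (n : nat) (pi : 'S_n) u : cross pi u u = 0.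
Proof. by rewrite /cross /cmp ltnn mul0r. Qed.

Lemma cross_sqr (n : nat) (pi : 'S_n) u v : cross pi u v ^+ 2 = (u != v)%:R.
Proof.
have cmp_sqr (a b : nat) : cmp a b ^+ 2 = (a != b)%:R.
  by rewrite /cmp; case: (ltngtP a b).
rewrite /cross exprMn !cmp_sqr -natrM mulnb.
by rewrite !(inj_eq val_inj) (inj_eq perm_inj) andbb.
Qed.

Definition triple (T : Type) := (T * T * T)%type.

Definition uniq3 (T : eqType) (t : triple T) := uniq [:: t.1.1; t.1.2; t.2].

Definition crosses (n : nat) (pi : 'S_n) (t : triple 'I_n) : int * int :=
  (cross pi t.1.1 t.1.2, cross pi t.1.1 t.2).

(** The pairs of a triple of positions are in order or inverted as its pattern
    dictates. *)
Lemma sum_triples_by_pattern (n : nat) (pi : 'S_n) (F : int * int -> int) :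
  \sum_(t : triple 'I_n | uniq3 t) F (crosses pi t) =
  \sum_(tau : 'S_3)
    (\sum_(t : triple 'I_3 | uniq3 t) F (crosses tau t)) *+ pattern_count tau pi.
Proof.
pose supp (t : triple 'I_n) := [set t.1.1; t.1.2; t.2].
have card_supp t : uniq3 t -> #|supp t| = 3%N.
  move=> /card_uniqP /= <-; apply: eq_card => y.
  by rewrite !inE -orbA.
rewrite (partition_big supp (fun S => #|S| == 3%N)) /=; last first.
  by move=> t /card_supp ->.
apply: sum_by_pattern => tau S occ_S.
have /eqP cardS : #|S| == 3%N by case/andP: occ_S.
case/occurrenceP: occ_S => x defS x_mono.
have x_inj : injective x.
  suff /imset_injP inj_x : #|[set x i | i : 'I_3]| == #|'I_3|.
    by move=> i j; apply: inj_x.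
  by rewrite -defS cardS card_ord.
pose h (t : triple 'I_3) : triple 'I_n := (x t.1.1, x t.1.2, x t.2).
have h_inj : injective h by move=> [[? ?] ?] [[? ?] ?] [/x_inj-> /x_inj-> /x_inj->].
have uniq_h t : uniq3 (h t) = uniq3 t
  by exact: (map_inj_uniq x_inj [:: t.1.1; t.1.2; t.2]).
transitivity (\sum_(t in [set h t | t in [pred t | uniq3 t]]) F (crosses pi t)).
  apply: eq_bigl => t; apply/andP/imsetP => [[ut /eqP suppt]|[s us ->]].
    have inS y : y \in supp t -> y \in [set x i | i : 'I_3] by rewrite suppt defS.
    have /imsetP[i _ ti] := inS t.1.1 ltac:(by rewrite !inE eqxx).
    have /imsetP[j _ tj] := inS t.1.2 ltac:(by rewrite !inE eqxx orbT).
    have /imsetP[l _ tl] := inS t.2 ltac:(by rewrite !inE eqxx !orbT).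
    have tE : t = h (i, j, l) by rewrite /h /= -ti -tj -tl; case: (t) => [[]].
    by exists (i, j, l); rewrite // inE -uniq_h -tE.
  rewrite uniq_h; split=> //; rewrite eqEcard card_supp ?uniq_h // cardS leqnn andbT.
  by apply/subsetP => y; rewrite !inE defS => /orP[/orP[]|] /eqP ->; apply: imset_f.
rewrite big_imset /=; last by move=> ? ? _ _; apply: h_inj.
apply: eq_bigr => t _; congr F.
have crossE i j : cross pi (x i) (x j) = cross tau i j.
  by congr (_ * _); apply: cmp_eq; case: (x_mono i j); case: (x_mono j i).
by rewrite /crosses /= !crossE.
Qed.

Lemma sum_triple (n : nat) (P : pred (triple 'I_n)) (F : triple 'I_n -> int) :
  \sum_(t | P t) F t = \sum_u \sum_v \sum_w if P (u, v, w) then F (u, v, w) else 0.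
Proof. by rewrite big_mkcond /= !pair_bigA; apply: eq_bigr => -[[u v] w]. Qed.

(** Expanding the squares gives terms s(u, v) s(u, w). Those with v = w are 1
    for u <> v, and those with u = v or u = w vanish, which leaves the triples
    of distinct points. *)
Lemma energyE (n : nat) (pi : 'S_n) :
  energy pi = (n * n.-1)%:R +
    \sum_(t : triple 'I_n | uniq3 t) (crosses pi t).1 * (crosses pi t).2.
Proof.
have -> : (n * n.-1)%:R = \sum_(u : 'I_n) \sum_(v : 'I_n) cross pi u v ^+ 2.
  under eq_bigr => u _.
    under eq_bigr => v _ do rewrite cross_sqr eq_sym.
    rewrite -natr_sum -big_mkcond sum1_card cardC1 card_ord; over.
  by rewrite sumr_const card_ord -mulrnA mulnC.
rewrite sum_triple -big_split; apply: eq_bigr => u _ /=.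
rewrite expr2 mulr_suml -big_split; apply: eq_bigr => v _ /=.
rewrite mulr_sumr (bigD1 v) //= [in RHS](bigD1 v) //= {1}/uniq3 /= !inE eqxx andbF.
rewrite add0r -expr2; congr (_ + _); apply: eq_bigr => w neq_wv.
rewrite /uniq3 /= !inE [v == w]eq_sym neq_wv !andbT negb_or.
case: eqP => [->|_]; first by rewrite crossxx mul0r.
by case: eqP => [->|_] //; rewrite crossxx mulr0.
Qed.

(** Each pair extends to n - 2 triples. *)
Lemma sum_cross_triples (n : nat) (pi : 'S_n) :
  \sum_(t : triple 'I_n | uniq3 t) (crosses pi t).1 =
  (\sum_u \sum_v cross pi u v) *+ (n - 2).
Proof.
rewrite sum_triple -sumrMnl; apply: eq_bigr => u _.
rewrite -sumrMnl; apply: eq_bigr => v _ /=; rewrite -big_mkcond /=.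
rewrite sumr_const; case: (eqVneq u v) => [->|neq_uv].
  by rewrite crossxx !mul0rn.
congr (_ *+ _); transitivity #|~: [set u; v]|; last first.
  by rewrite -[in RHS](card_ord n) -(cardsC [set u; v]) cards2 neq_uv addKn.
apply: eq_card => w; rewrite !inE unfold_in /= !inE andbT.
by rewrite (negPf neq_uv) /= ![w == _]eq_sym negb_or.
Qed.

Lemma sum_triple3 (F : triple 'I_3 -> int) :
  let: (a, b, c) := (ord0, lift ord0 ord0, lift ord0 (lift ord0 ord0)) in
  \sum_(t : triple 'I_3 | uniq3 t) F t =
  F (a, b, c) + F (a, c, b) + (F (b, a, c) + F (b, c, a)) +
  (F (c, a, b) + F (c, b, a)).
Proof.
by rewrite /= sum_triple !big_ord_recl !big_ord0 /uniq3 /= !add0r !addr0 ?addrA.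
Qed.

(** * Balance from symmetry and energy *)

(** The six patterns in the order of the two orbits of the rotation
    tau |-> tau^-1 * r: first 123 and 321, then the other four. *)
Definition perms3 : seq 'S_3 :=
  let c := tperm ord0 (lift ord0 ord0) in let r := rev_perm 3 in
  [:: 1; r; c; c * r; r * c * r; r * c]%g.

Lemma mem_all_perms (k : nat) (l : seq 'S_k) :
  uniq l -> size l = k`! -> l =i predT.
Proof.
move=> uniq_l size_l tau; rewrite inE.
have sub : l \subset predT by apply/subsetP.
suff /subsetP -> : predT \subset l by [].
rewrite -(geq_leqif (subset_leqif_card sub)) (card_uniqP uniq_l) size_l.
by rewrite (card_Sn k).
Qed.

Lemma sum_all_perms (k : nat) (l : seq 'S_k) (V : nmodType) (F : 'S_k -> V) :
  uniq l -> size l = k`! -> \sum_tau F tau = \sum_(tau <- l) F tau.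
Proof.
move=> uniq_l size_l; rewrite [RHS]big_uniq //=; apply: eq_bigl => tau.
by rewrite mem_all_perms.
Qed.

Lemma uniq_perms3 : uniq perms3.
Proof.
apply: (@map_uniq _ _ (fun t : 'S_3 => t ord0 + t (lift ord0 ord0) * 3)%N).
by rewrite /= !permM !permE.
Qed.

Lemma sum_perms3 (V : nmodType) (F : 'S_3 -> V) :
  \sum_tau F tau = \sum_(tau <- perms3) F tau.
Proof. exact: sum_all_perms uniq_perms3 erefl. Qed.

Lemma perms3_cross_sum :
  [seq \sum_(t : triple 'I_3 | uniq3 t) (crosses tau t).1 | tau <- perms3] =
  [:: 6; -6; 2; -2; 2; -2].
Proof. by rewrite /= !sum_triple3 /cross /= !permM !permE. Qed.

(** A monotone triple has equal signs s, so its six products are 1. In the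
    other triples one sign differs from the other two, and the products sum
    to -2. *)
Lemma perms3_cross_prod :
  [seq \sum_(t : triple 'I_3 | uniq3 t)
         (crosses tau t).1 * (crosses tau t).2 | tau <- perms3] =
  [:: 6; 6; -2; -2; -2; -2].
Proof. by rewrite /= !sum_triple3 /cross /= !permM !permE. Qed.

Lemma mul_bin3 (n : nat) :
  ('C(n, 3)%:Z * 6 = n%:Z * (n%:Z - 1) * (n%:Z - 2))%R.
Proof.
case: n => [|[|n]] //.
have := bin_ffact n.+2 3; rewrite !ffactnSr ffactn0 (_ : 3`! = 6)%N //; lia.
Qed.

(** Let p be the number of occurrences of 123, or of 321, and q that of any
    other pattern. Then 2 p + 4 q = binomial(n, 3), and the energy is
    n (n - 1) + 12 p - 8 q. The two equations determine p and q, and the given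
    value of the energy is the one for which p = q. *)
Lemma rotational_balanced3 (n : nat) (pi : 'S_n) : rotational pi ->
  energy pi * 9 = n%:Z * (n%:Z - 1) * (n%:Z + 7) -> balanced 3 pi.
Proof.
set c := tperm ord0 (lift ord0 ord0) : 'S_3.
have invr : ((rev_perm 3)^-1 = rev_perm 3)%g.
  by apply/eqP; rewrite eq_invg_mul rev_permK.
move=> rot_pi; have rot (t : 'S_3) := pattern_count_rot t rot_pi.
have cr : pattern_count (rev_perm 3) pi = pattern_count (1%g : 'S_3) pi.
  by have := rot 1%g; rewrite invg1 mul1g.
have c1 : pattern_count (c * rev_perm 3)%g pi = pattern_count c pi.
  by rewrite -(rot c) tpermV.
have c2 : pattern_count (rev_perm 3 * c * rev_perm 3)%g pi = pattern_count c pi.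
  by rewrite -c1 -(rot (c * _)%g) invMg tpermV invr.
have c3 : pattern_count (rev_perm 3 * c)%g pi = pattern_count c pi.
  by rewrite -c2 -(rot (_ * c * _)%g) !invMg tpermV invr -!mulgA rev_permK mulg1.
rewrite energyE (sum_triples_by_pattern pi (fun a => a.1 * a.2)).
have := sum_pattern_count 3 pi; have bin3 := mul_bin3 n.
rewrite !sum_perms3 /perms3 !big_cons !big_nil.
case: perms3_cross_prod => -> -> -> -> -> ->.
rewrite -/c cr c1 c2 c3 => sumC sumE.
have [eq1 eqc] : (pattern_count (1%g : 'S_3) pi * 6 = 'C(n, 3) /\
                  pattern_count c pi * 6 = 'C(n, 3))%N.
  have nE : n * n.-1 = n%:Z * (n%:Z - 1) :> int by clear; case: n => //= m; lia.
  have mulrnZ (x : int) m : x *+ m = x * m%:Z by rewrite -mulr_natr natz.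
  move: sumE sumC bin3; rewrite ![_ *+ pattern_count _ _]mulrnZ natz nE.
  move: (pattern_count _ pi) (pattern_count c pi) ('C(n, 3)) (n : int) => p q C m.
  clear => sumE; rewrite -[_ = C]/((p + (p + (q + (q + (q + (q + 0))))))%N = C).
  move=> sumC bin3.
  (* m (m - 1) (m + 7) - 9 m (m - 1) = m (m - 1) (m - 2) = 6 C *)
  have {}sumE : p%:Z * 36 - q%:Z * 24 = 2 * C%:Z.
    have : m * (m - 1) * (m + 7) = m * (m - 1) * (m - 2) + 9 * (m * (m - 1)) by ring.
    move: (m * (m - 1)) sumE bin3 => mm; move: (mm * (m - 2)) (mm * (m + 7)).
    lia.
  lia.
apply/balancedP => tau; rewrite (_ : 3`! = 6)%N //.
have := mem_all_perms uniq_perms3 erefl tau.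
rewrite /perms3 !inE -/c.
by do ![case/orP]; move/eqP => ->; rewrite ?cr ?c1 ?c2 ?c3.
Qed.

Lemma rotational_balanced2 (n : nat) (pi : 'S_n) : rotational pi -> balanced 2 pi.
Proof.
move=> rot_pi; pose l : seq 'S_2 := [:: 1; rev_perm 2]%g.
have uniq_l : uniq l.
  by apply: (@map_uniq _ _ (fun t : 'S_2 => t ord0 : nat)); rewrite /= !permE.
have cr : pattern_count (rev_perm 2) pi = pattern_count (1%g : 'S_2) pi.
  by have := pattern_count_rot (1%g : 'S_2) rot_pi; rewrite invg1 mul1g.
have := sum_pattern_count 2 pi.
rewrite (sum_all_perms _ uniq_l) // !big_cons big_nil cr => sumC.
apply/balancedP => tau; rewrite (_ : 2`! = 2)%N // -sumC muln2 -addnn.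
have := mem_all_perms uniq_l erefl tau.
by rewrite !inE => /orP[] /eqP ->; rewrite ?cr addr0.
Qed.

Lemma balanced1 (n : nat) (pi : 'S_n) : balanced 1 pi.
Proof.
have mem1 := @mem_all_perms 1 [:: 1%g] isT erefl.
have := sum_pattern_count 1 pi.
rewrite (@sum_all_perms 1 [:: 1%g]) // big_seq1 => sumC.
apply/balancedP => tau; rewrite -sumC muln1.
by have := mem1 tau; rewrite !inE => /eqP ->.
Qed.

(** In the sum of s over all triples the contributions of a pattern and of its
    reversal cancel. So the sum over triples vanishes for a balanced
    permutation, and with it the sum over pairs. This makes binomial(n, 2)
    twice the number of inversions. *)
Lemma balanced3_even (n : nat) (pi : 'S_n) :
  (2 < n)%N -> balanced 3 pi -> (2 %| 'C(n, 2))%N.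
Proof.
move=> n_gt2 /balancedP bal.
have balE (tau : 'S_3) : pattern_count tau pi = pattern_count (1%g : 'S_3) pi.
  by apply/eqP; rewrite -(@eqn_pmul2r 3`!%N) // !bal.
have sum0 : \sum_u \sum_v cross pi u v = 0.
  apply/eqP; have := sum_cross_triples pi.
  rewrite (sum_triples_by_pattern pi (fun a => a.1)).
  under eq_bigr => tau _ do rewrite balE.
  rewrite sum_perms3 /perms3 !big_cons !big_nil.
  case: perms3_cross_sum => -> -> -> -> -> ->.
  rewrite addr0 -!mulrnDl [X in X *+ pattern_count _ _](_ : _ = 0) // mul0rn => /esym/eqP.
  by rewrite mulrn_eq0 subn_eq0 leqNgt n_gt2.
pose inv (u v : 'I_n) := ((u < v) && (pi v < pi u))%N.
pose I := (\sum_u \sum_v inv u v)%N.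
have crossE u v : cross pi u v = (u != v)%:R - ((inv u v)%:R + (inv v u)%:R) *+ 2.
  have [->|neq_uv] := eqVneq u v; first by rewrite crossxx /inv ltnn.
  have := neq_uv; have := neq_uv; rewrite -{1}(inj_eq (@perm_inj _ pi)) -!val_eqE /=.
  rewrite /cross /cmp /inv.
  by case: (ltngtP u v) => // _; case: (ltngtP (pi u) (pi v)).
have sum_inv : (\sum_u \sum_v inv u v)%:R = \sum_u \sum_v (inv u v)%:R :> int.
  by rewrite natr_sum; apply: eq_bigr => u _; rewrite natr_sum.
have nE : \sum_(u : 'I_n) \sum_(v : 'I_n) (u != v)%:R = (n * n.-1)%:R :> int.
  under eq_bigr => u _.
    under eq_bigr => v _ do rewrite eq_sym.
    rewrite -natr_sum -big_mkcond sum1_card cardC1 card_ord; over.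
  by rewrite sumr_const card_ord -mulrnA mulnC.
have crossS : \sum_u \sum_v cross pi u v = \sum_(u : 'I_n) \sum_v (u != v)%:R -
    (\sum_u \sum_v (inv u v)%:R + \sum_u \sum_v (inv v u)%:R) *+ 2.
  rewrite -big_split -sumrMnl -sumrB; apply: eq_bigr => u _.
  rewrite -big_split -sumrMnl -sumrB; apply: eq_bigr => v _; exact: crossE.
move: crossS; rewrite sum0 nE [X in (_ + X) *+ _]exchange_big -sum_inv /= => crossS.
have := bin_ffact n 2; rewrite !ffactnSr ffactn0 (_ : 2`! = 2)%N // => binE.
move: crossS; rewrite -mulr2n -!mulrnA !natz.
move: (\sum_u _)%N => m.
lia.
Qed.

(** * Wrapping a permutation in a ring *)

(** In the composite of an inner permutation of size n and a ring of size
    2 (a + b), the positions are, from left to right: a of the ring, the left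
    half of the inner permutation, b of the ring, the middle inner position if n
    is odd, b of the ring, the right half of the inner permutation, and a of
    the ring. The values are arranged in the same way. *)
Definition inner_pos (n a b i : nat) : nat :=
  if (i.*2.+1 < n)%N then i + a
  else if i.*2.+1 == n then i + a + b else i + a + b.*2.

Definition ring_pos (n a b p : nat) : nat :=
  if (p < a)%N then p else if (p < a + b)%N then p + n./2
  else if (p < a + b.*2)%N then p + uphalf n else p + n.

(** The sign of a comparison between an inner position and the ring position p
    depends only on the half h of the inner position: -1 for the right half, 1
    for the left half and 0 for the middle. *)
Definition view (a b : nat) (h : int) (p : nat) : int :=
  if (p < a)%N then -1 else if (a + b.*2 <= p)%N then 1
  else if h == 0 then (if (p < a + b)%N then -1 else 1) else h.

Definition side (n i : nat) : int := cmp i.*2.+1 n.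

Lemma cmp_inner (n a b i j : nat) :
  cmp (inner_pos n a b i) (inner_pos n a b j) = cmp i j.
Proof.
apply: cmp_eq; rewrite /inner_pos.
  by case: (ltngtP i.*2.+1 n); case: (ltngtP j.*2.+1 n); lia.
by case: (ltngtP i.*2.+1 n); case: (ltngtP j.*2.+1 n); lia.
Qed.

Lemma cmp_ring (n a b p q : nat) :
  cmp (ring_pos n a b p) (ring_pos n a b q) = cmp p q.
Proof.
have ltn_ring x y : (x < y)%N -> (ring_pos n a b x < ring_pos n a b y)%N.
  rewrite /ring_pos; have := uphalf_half n; have := odd_double_half n.
  by do 6?case: ifP; lia.
rewrite /cmp; case: (ltngtP p q) => [/ltn_ring|/ltn_ring|->]; last by rewrite ltnn.
  by case: ltngtP.
by case: ltngtP.
Qed.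

Lemma cmp_inner_ring (n a b i p : nat) : (i < n)%N ->
  cmp (inner_pos n a b i) (ring_pos n a b p) = view a b (side n i) p.
Proof.
move=> lt_in; rewrite /cmp /view /side /cmp /inner_pos /ring_pos.
have := uphalf_half n; have := odd_double_half n.
case: (ltngtP i.*2.+1 n) => //= ?; do !case: ifP => //=; lia.
Qed.

Definition place (n a b : nat) (x : 'I_n + 'I_(a + b).*2) : nat :=
  match x with inl i => inner_pos n a b i | inr p => ring_pos n a b p end.

Lemma place_lt (n a b : nat) x : (@place n a b x < n + (a + b).*2)%N.
Proof.
case: x => x; have := ltn_ord x; rewrite /= /inner_pos /ring_pos.
  by do !case: ifP; lia.
by have := uphalf_half n; have := odd_double_half n; do !case: ifP; lia.
Qed.

Definition rev_sum (n m : nat) (x : 'I_n + 'I_m) : 'I_n + 'I_m :=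
  match x with inl i => inl (rev_ord i) | inr p => inr (rev_ord p) end.

Lemma place_rev (n a b : nat) x :
  @place n a b (rev_sum x) = (n + (a + b).*2 - (place x).+1)%N.
Proof.
case: x => x; have := ltn_ord x; rewrite /= /inner_pos /ring_pos.
  by case: (ltngtP x.*2.+1 n) => ? ?; do !case: ifP; lia.
have := uphalf_half n; have := odd_double_half n.
by move=> ? ? ?; do !case: ifP; lia.
Qed.

Lemma cmpxx (x : nat) : cmp x x = 0.
Proof. by rewrite /cmp ltnn. Qed.

Lemma cmp_eq0 (x y : nat) : (cmp x y == 0) = (x == y).
Proof. by rewrite /cmp; case: ltngtP. Qed.

(** The arrangement of positions is invariant under the reversal, so the
    composite is again rotational. In its energy, mixed i p is the sign of the
    pair formed by the inner point i and the ring point p. *)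
Lemma nest (n a b : nat) (pi : 'S_n) (sigma : 'S_(a + b).*2) :
  rotational pi -> rotational sigma ->
  exists2 tau : 'S_(n + (a + b).*2), rotational tau &
  let mixed (i : 'I_n) (p : 'I_(a + b).*2) :=
    view a b (side n i) p * view a b (side n (pi i)) (sigma p) in
  energy tau = \sum_i (\sum_j cross pi i j + \sum_p mixed i p) ^+ 2 +
               \sum_p (\sum_i mixed i p + \sum_q cross sigma p q) ^+ 2.
Proof.
move=> rot_pi rot_sigma.
pose pos x : 'I_(n + (a + b).*2) := Ordinal (@place_lt n a b x).
pose rho (x : 'I_n + 'I_(a + b).*2) : 'I_n + 'I_(a + b).*2 :=
  match x with inl i => inl (pi i) | inr p => inr (sigma p) end.
have view_neq0 h p : view a b h p != 0.
  rewrite /view; case: ifP => // _; case: ifP => // _.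
  by case: ifP => [_|->] //; case: ifP.
have mixed_neq i p : inner_pos n a b (i : 'I_n) <> ring_pos n a b p.
  move=> eq_ip; have := cmp_inner_ring a b p (ltn_ord i).
  by rewrite eq_ip cmpxx => /esym/eqP; rewrite (negPf (view_neq0 _ _)).
have pos_inj : injective pos.
  move=> [i|p] [j|q] [/= eq_pos].
  - congr inl; apply/val_inj/eqP.
    by rewrite -cmp_eq0 -(cmp_inner n a b) eq_pos cmpxx.
  - by case: (mixed_neq i q).
  - by case: (mixed_neq j p).
  - congr inr; apply/val_inj/eqP.
    by rewrite -cmp_eq0 -(cmp_ring n a b) eq_pos cmpxx.
have rho_inj : injective rho.
  by move=> [i|p] [j|q] [] // /perm_inj ->.
have [|posV posK posVK] := inj_card_bij pos_inj.
  by rewrite card_sum !card_ord.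
have tau_inj : injective (pos \o rho \o posV).
  exact: inj_comp (inj_comp pos_inj rho_inj) (can_inj posVK).
have tauE x : perm tau_inj (pos x) = pos (rho x) by rewrite permE /= posK.
exists (perm tau_inj) => [y|/=].
  rewrite -(posVK y) !tauE; apply: val_inj => /=; rewrite -place_rev.
  by case: (posV y) => x /=; rewrite ?rot_pi ?rot_sigma.
have cross_inner i j : cross (perm tau_inj) (pos (inl i)) (pos (inl j)) = cross pi i j.
  by rewrite /cross !tauE /= !cmp_inner.
have cross_ring p q : cross (perm tau_inj) (pos (inr p)) (pos (inr q)) = cross sigma p q.
  by rewrite /cross !tauE /= !cmp_ring.
have cross_mixed i p : cross (perm tau_inj) (pos (inl i)) (pos (inr p)) =
    view a b (side n i) p * view a b (side n (pi i)) (sigma p).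
  by rewrite /cross !tauE /= !cmp_inner_ring.
have bij_pos : bijective pos by exists posV.
rewrite /energy (reindex pos) /=; last exact: onW_bij.
rewrite big_sumType /=; congr (_ + _); apply: eq_bigr => x _; congr (_ ^+ 2);
  rewrite (reindex pos) /= ?big_sumType /=; try exact: onW_bij.
  by congr (_ + _); apply: eq_bigr => y _; rewrite ?cross_inner ?cross_mixed.
by congr (_ + _); apply: eq_bigr => y _; rewrite ?cross_ring // crossC cross_mixed.
Qed.

(** * What the ring points see *)

Definition outer (a b p : nat) : bool := ((p < a) || (a + b.*2 <= p))%N.

Definition ring_side (a b p : nat) : int := if (p < a + b)%N then -1 else 1.

(** All inner positions are on the same side of an outer position. *)
Lemma view_outer (a b p : nat) h : outer a b p -> view a b h p = ring_side a b p.
Proof.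
rewrite /outer /view /ring_side.
case: ltnP => //= [lt_pa _|_ le_abp]; first by rewrite (leq_trans lt_pa) ?leq_addr.
by rewrite le_abp ltnNge (leq_trans _ le_abp) // leq_add2l -addnn leq_addr.
Qed.

Lemma sum_side (n : nat) : \sum_(i < n) side n i = 0.
Proof.
have side_rev (i : 'I_n) : side n (rev_ord i) = - side n i.
  rewrite /side cmpC; congr (- _); have := ltn_ord i => ltin.
  by apply: cmp_eq => /=; lia.
suff : \sum_(i < n) side n i = - \sum_(i < n) side n i by lia.
rewrite {1}(reindex_inj rev_ord_inj) -sumrN.
by apply: eq_bigr => i _; apply: side_rev.
Qed.

Lemma card_side_eq0 (n : nat) : \sum_(i < n) (side n i == 0)%:R = (odd n)%:R :> int.
Proof.
under eq_bigr => i _ do rewrite /side cmp_eq0.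
have := odd_double_half n; case: (odd n) => nE.
  have lt_mid : (n./2 < n)%N by lia.
  rewrite (bigD1 (Ordinal lt_mid)) //= big1 ?addr0 => [|i].
    by rewrite (_ : _ == _) //; lia.
  by rewrite -val_eqE /=; case: eqP => // ?; lia.
by rewrite big1 // => i _; case: eqP => // ?; lia.
Qed.

(** A middle position has the two halves on its two sides, and they cancel; only
    the middle inner position, present for odd n, remains. *)
Lemma sum_view_mid (n a b p : nat) : ~~ outer a b p ->
  \sum_(i < n) view a b (side n i) p = (odd n)%:R * ring_side a b p.
Proof.
move=> mid_p; rewrite -card_side_eq0 mulr_suml -[LHS]subr0 -[X in _ - X](sum_side n).
rewrite -sumrB.
apply: eq_bigr => i _ /=; rewrite /view; move: mid_p; rewrite /outer negb_or.
case/andP=> /negPf -> /negPf ->; rewrite /ring_side.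
by case: eqP => [->|_]; rewrite ?mul1r ?mul0r ?subr0 ?subrr.
Qed.

(** If only one coordinate of a ring point is outer, then that coordinate
    contributes a constant sign, and the other one cancels as in
    [sum_view_mid]. *)
Lemma sum_view_mixed (n a b p q : nat) (pi : 'S_n) : outer a b p || outer a b q ->
  \sum_(i < n) view a b (side n i) p * view a b (side n (pi i)) q =
  (if outer a b p && outer a b q then n%:R else (odd n)%:R) *
  (ring_side a b p * ring_side a b q).
Proof.
have [out_p|mid_p] /= := boolP (outer a b p); last first.
  move=> out_q; under eq_bigr => i _ do rewrite (view_outer _ out_q).
  by rewrite -mulr_suml sum_view_mid // mulrA.
under eq_bigr => i _ do rewrite (view_outer _ out_p).
rewrite -mulr_sumr => _; have [out_q|mid_q] := boolP (outer a b q).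
  under eq_bigr => i _ do rewrite (view_outer _ out_q).
  by rewrite sumr_const card_ord mulrnAr mulr_natl.
transitivity (ring_side a b p * \sum_(i < n) view a b (side n i) q).
  by rewrite [in RHS](reindex_inj (@perm_inj _ pi)).
by rewrite sum_view_mid // mulrCA.
Qed.

Lemma sum_sqr_split (m : nat) (o : pred nat) (s e : nat -> int) (x z : int) :
  \sum_(p < m) ((if o p then x else z) * s p + e p) ^+ 2 =
  \sum_(p < m) e p ^+ 2 +
  2 * x * \sum_(p < m) (if o p then s p * e p else 0) +
  2 * z * \sum_(p < m) (if o p then 0 else s p * e p) +
  x ^+ 2 * \sum_(p < m) (if o p then s p ^+ 2 else 0) +
  z ^+ 2 * \sum_(p < m) (if o p then 0 else s p ^+ 2).
Proof.
rewrite !mulr_sumr -!big_split; apply: eq_bigr => p _ /=.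
by case: (o p); ring.
Qed.

(** * Permutations given by lists *)

Lemma perm_of_seq (n : nat) (l : seq nat) :
  all (fun i => (nth 0 l i < n) && (nth 0 l (nth 0 l i) == n - i.+1))%N (iota 0 n) ->
  exists2 pi : 'S_n, rotational pi & forall i, pi i = nth 0%N l i :> nat.
Proof.
move=> /allP all_l.
have lP (i : 'I_n) : (nth 0 l i < n)%N /\ nth 0%N l (nth 0%N l i) = (n - i.+1)%N.
  by have /andP[-> /eqP ->] := all_l i ltac:(by rewrite mem_iota /=).
pose f i : 'I_n := Ordinal (proj1 (lP i)).
have ff i : f (f i) = rev_ord i by apply: val_inj; case: (lP i).
have f_inj : injective f by move=> i j /(congr1 f); rewrite !ff; apply: rev_ord_inj.
by exists (perm f_inj) => [i|i]; rewrite !permE.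
Qed.

(** Sums over ordinals are locked; this form of them evaluates. *)
Definition sum_iota (m : nat) (f : nat -> int) : int :=
  foldr (fun p s => f p + s) 0 (iota 0 m).

Lemma sum_iotaE (m : nat) (f : nat -> int) : \sum_(p < m) f p = sum_iota m f.
Proof. by rewrite -(big_mkord xpredT f) unlock /index_iota subn0. Qed.

Definition row_sum (l : seq nat) (p : nat) : int :=
  sum_iota (size l) (fun q => cmp p q * cmp (nth 0%N l p) (nth 0%N l q)).

Lemma row_sumE (l : seq nat) (n : nat) (pi : 'S_n) (p : 'I_n) : size l = n ->
  (forall i, pi i = nth 0%N l i :> nat) -> \sum_q cross pi p q = row_sum l p.
Proof.
move=> size_l piE; rewrite /row_sum size_l -sum_iotaE; apply: eq_bigr => q _.
by rewrite /cross !piE.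
Qed.

(** The rotational permutations that [rotational_balanced3] applies to. *)
Definition tuned (n : nat) := exists2 pi : 'S_n,
  rotational pi & energy pi * 9 = n%:Z * (n%:Z - 1) * (n%:Z + 7).

Definition tuned_seq (l : seq nat) : bool :=
  let n := size l in
  all (fun i => (nth 0 l i < n) && (nth 0 l (nth 0 l i) == n - i.+1))%N (iota 0 n) &&
  (sum_iota n (fun p => row_sum l p ^+ 2) * 9 == n%:Z * (n%:Z - 1) * (n%:Z + 7)).

Lemma tuned_of_seq (l : seq nat) : tuned_seq l -> tuned (size l).
Proof.
case/andP => /perm_of_seq[pi rot_pi piE] /eqP energy_l; exists pi => //.
rewrite -energy_l -sum_iotaE; congr (_ * _); apply: eq_bigr => p _.
by rewrite (row_sumE p erefl piE).
Qed.

(** * Construction of balanced permutations *)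

(** One permutation for each of the twelve residues modulo 72 allowed by the
    divisibility conditions. *)
Definition base_seqs : seq (seq nat) := [::
  [::];
  [:: 0];
  [:: 6; 5; 0; 1; 4; 7; 8; 3; 2];
  [:: 8; 2; 18; 5; 6; 16; 15; 9; 19; 12; 7; 0; 10; 4; 3; 13; 14; 1; 17; 11];
  [:: 20; 22; 18; 15; 16; 1; 10; 0; 13; 2; 21; 4; 3; 19; 8; 24; 23; 6; 25;
      14; 27; 17; 26; 11; 12; 9; 5; 7];
  [:: 8; 5; 10; 24; 3; 27; 15; 11; 28; 16; 26; 21; 9; 6; 14; 22; 19; 7; 2;
      12; 0; 17; 13; 1; 25; 4; 18; 23; 20];
  [:: 8; 4; 21; 7; 34; 23; 26; 32; 35; 6; 18; 16; 5; 20; 2; 13; 24; 10; 25;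
      11; 22; 33; 15; 30; 19; 17; 29; 0; 3; 9; 12; 1; 28; 14; 31; 27];
  [:: 1; 36; 12; 11; 26; 17; 20; 23; 21; 22; 4; 33; 34; 7; 9; 8; 6; 31; 18;
      5; 30; 28; 27; 29; 2; 3; 32; 14; 15; 13; 16; 19; 10; 25; 24; 0; 35];
  [:: 4; 10; 14; 31; 44; 28; 25; 29; 32; 33; 43; 9; 8; 3; 42; 7; 5; 23; 20;
      6; 26; 17; 22; 27; 18; 38; 24; 21; 39; 37; 2; 41; 36; 35; 1; 11; 12;
      15; 19; 16; 0; 13; 30; 34; 40];
  [:: 34; 7; 13; 45; 9; 18; 23; 54; 31; 51; 3; 29; 39; 53; 36; 33; 12; 35;
      50; 14; 17; 0; 15; 49; 8; 27; 11; 30; 25; 44; 28; 47; 6; 40; 55; 38;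
      41; 5; 20; 43; 22; 19; 2; 16; 26; 52; 4; 24; 1; 32; 37; 46; 10; 42;
      48; 21];
  [:: 47; 54; 19; 51; 13; 39; 56; 6; 40; 1; 26; 36; 3; 59; 21; 31; 0; 22;
      34; 61; 35; 49; 46; 8; 5; 33; 53; 11; 20; 18; 25; 48; 15; 38; 45; 43;
      52; 10; 30; 58; 55; 17; 14; 28; 2; 29; 41; 63; 32; 42; 4; 60; 27; 37;
      62; 23; 57; 7; 24; 50; 12; 44; 9; 16];
  [:: 6; 28; 61; 2; 10; 33; 64; 37; 38; 24; 60; 29; 18; 43; 41; 30; 47; 16;
      52; 42; 25; 13; 19; 14; 55; 44; 8; 7; 63; 53; 49; 5; 32; 59; 15; 11;
      1; 57; 56; 20; 9; 50; 45; 51; 39; 22; 12; 48; 17; 34; 23; 21; 46; 35;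
      4; 40; 26; 27; 0; 31; 54; 62; 3; 36; 58]]%N.

Lemma tuned_base (r : nat) :
  (r < 72)%N -> (r %% 36 \in [:: 0; 1; 9; 20; 28; 29])%N -> tuned r.
Proof.
move=> lt_r; have : r \in iota 0 72 by rewrite mem_iota.
have : all (fun r => (r %% 36 \in [:: 0; 1; 9; 20; 28; 29]) ==>
                     (r \in map size base_seqs))%N (iota 0 72) by [].
move=> /allP base /base/implyP base_r /base_r /mapP[l l_base ->].
apply: tuned_of_seq; move: l l_base; apply/allP.
by vm_compute.
Qed.

(** A rotational permutation of size 72 for a = 24 and b = 12, without points in
    the central block and with the five sums that [tuned_step] needs. In the
    notation of that lemma, a ring of 36 points would have 12 corners p, and the
    sum of s p * e p over them would have to be 240. This is impossible: a
    quarter turn changes the signs of both s p and e p, so the sum is 4 times a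
    sum of 3 odd numbers. *)
Definition ring_seq : seq nat :=
  [:: 67; 35; 64; 53; 0; 52; 34; 2; 33; 32; 29; 59; 11; 28; 45; 27; 30; 25;
      3; 5; 24; 23; 40; 50; 51; 54; 14; 56; 58; 61; 55; 22; 62; 63; 65; 70;
      1; 6; 8; 9; 49; 16; 10; 13; 15; 57; 17; 20; 21; 31; 48; 47; 66; 68;
      46; 41; 44; 26; 43; 60; 12; 42; 39; 38; 69; 37; 19; 71; 18; 7; 36; 4]%N.

(** The middle position is the fixed point of the reversal; as pi commutes with
    the reversal, pi maps the middle position to the middle value. *)
Lemma side_eq0 (n : nat) (i : 'I_n) : (side n i == 0) = (rev_ord i == i).
Proof.
by rewrite /side cmp_eq0 -val_eqE /=; have := ltn_ord i; do 2!case: eqP; lia.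
Qed.

(** Let e p be the row sum of p inside the ring and s p the sign of the quadrant
    of p that contains the centre. Nesting replaces e p by e p + n s p at the
    corners and by e p + (n mod 2) s p at the side points, and leaves the row
    sums of the inner points unchanged. The energy grows by
    44872 + 2 n 912 + 24 n^2 + (n mod 2) (48 - 2 * 24), which is
    the ninth part of the increase of n (n - 1) (n + 7) from n to n + 72. *)
Lemma tuned_step (n : nat) : tuned n -> tuned (n + 72).
Proof.
case=> pi rot_pi energy_pi.
have [sigma rot_sigma sigmaE] := @perm_of_seq (24 + 12).*2 ring_seq isT.
have [tau rot_tau /= energy_tau] := nest rot_pi rot_sigma.
exists tau; first exact: rot_tau.
pose corner p := outer 24 12 p && outer 24 12 (nth 0%N ring_seq p).
pose s p := ring_side 24 12 p * ring_side 24 12 (nth 0%N ring_seq p).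
have side_vals i : side n i \in [:: -1; 0; 1].
  by rewrite /side /cmp; do !case: ifP.
have inner0 (i : 'I_n) : \sum_(p < (24 + 12).*2) view 24 12 (side n i) p *
    view 24 12 (side n (pi i)) (sigma p) = 0.
  under eq_bigr => p _ do rewrite sigmaE.
  rewrite (sum_iotaE _ (fun p => view 24 12 (side n i) p *
    view 24 12 (side n (pi i)) (nth 0%N ring_seq p))).
  (* Only whether i and pi i lie before, at or after the middle matters, so the
     cancellation is a finite check. A pair with exactly one of h and g zero
     does not occur, and for such a pair the cancellation may fail. *)
  have : all (fun h => all (fun g => ((h == 0) == (g == 0)) ==>
    (sum_iota 72 (fun p => view 24 12 h p *
    view 24 12 g (nth 0%N ring_seq p)) == 0)) [:: -1; 0; 1]) [:: -1; 0; 1].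
    by vm_compute.
  move=> /allP/(_ _ (side_vals i))/allP/(_ _ (side_vals (pi i))).
  by rewrite !side_eq0 -rot_pi rot_pi -!rot_pi !(inj_eq perm_inj) eqxx => /eqP.
have no_mid p : (p < 72)%N -> outer 24 12 p || outer 24 12 (nth 0%N ring_seq p).
  move=> lt_p; have : p \in iota 0 72 by rewrite mem_iota.
  by move: p {lt_p}; apply/allP.
have : energy tau = energy pi + \sum_(p < 72)
    ((if corner p then n%:R else (odd n)%:R) * s p + row_sum ring_seq p) ^+ 2.
  rewrite energy_tau; congr (_ + _); apply: eq_bigr => i _; congr (_ ^+ 2).
    by rewrite inner0 addr0.
  rewrite (row_sumE _ _ sigmaE) //; congr (_ + _).
  by rewrite sum_view_mixed sigmaE // no_mid.
rewrite sum_sqr_split.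
rewrite (sum_iotaE 72 (fun p => row_sum ring_seq p ^+ 2)).
rewrite (sum_iotaE 72 (fun p => if corner p then s p * row_sum ring_seq p else 0)).
rewrite (sum_iotaE 72 (fun p => if corner p then 0 else s p * row_sum ring_seq p)).
rewrite (sum_iotaE 72 (fun p => if corner p then s p ^+ 2 else 0)).
rewrite (sum_iotaE 72 (fun p => if corner p then 0 else s p ^+ 2)).
rewrite (_ : sum_iota _ _ = 71 * 79 * 8); last by apply/eqP; vm_compute.
rewrite (_ : sum_iota _ _ = 912); last by apply/eqP; vm_compute.
rewrite (_ : sum_iota _ _ = -24); last by apply/eqP; vm_compute.
rewrite (_ : sum_iota _ _ = 24); last by apply/eqP; vm_compute.
rewrite (_ : sum_iota _ _ = 48); last by apply/eqP; vm_compute.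
move=> energy_tau'; rewrite [energy _](energy_tau') mulrDl energy_pi natz PoszD.
by case: (odd n) => /=; ring.
Qed.

Lemma tuned_exists (n : nat) :
  (n %% 36 \in [:: 0; 1; 9; 20; 28; 29])%N -> tuned n.
Proof.
rewrite {2}(divn_eq n 72) -(@modn_dvdm 72) // => tuned_r.
elim: (n %/ 72)%N => [|q IHq]; first by apply: tuned_base; rewrite ?ltn_pmod.
by rewrite mulSnr addnAC; apply: tuned_step.
Qed.

(** Wrapping in the ring 2413, which consists of four corners, adds 4 to n. *)
Lemma rotational_exists (n : nat) :
  (n %% 4 \in [:: 0; 1])%N -> exists pi : 'S_n, rotational pi.
Proof.
move=> n_mod4; rewrite (divn_eq n 4); elim: (n %/ 4)%N => [|q [pi rot_pi]].
  by move: n_mod4; rewrite !inE => /orP[] /eqP ->; exists 1%g => -[[]] // ?;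
    rewrite !perm1; apply: val_inj.
have [sigma rot_sigma _] := @perm_of_seq (2 + 0).*2 [:: 1; 3; 0; 2]%N isT.
have [tau rot_tau _] := nest rot_pi rot_sigma.
by rewrite mulSnr addnAC; exists tau.
Qed.

Lemma balanced3_exists (n : nat) :
  (n %% 36 \in [:: 0; 1; 9; 20; 28; 29])%N -> exists pi : 'S_n, balanced 3 pi.
Proof.
by move=> /tuned_exists[pi rot_pi energy_pi]; exists pi; apply: rotational_balanced3.
Qed.

(** * The divisibility conditions *)

Lemma dvdn_bin2 (n : nat) : (2 %| 'C(n, 2))%N = (n %% 4 \in [:: 0; 1])%N.
Proof.
have binE : ('C(n, 2) * 2 = n * n.-1)%N.
  by have := bin_ffact n 2; rewrite !ffactnSr ffactn0 (_ : 2`! = 2)%N //; lia.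
rewrite -(@dvdn_pmul2r 2) // binE.
case: n {binE} => [|m] //=.
have : (m %% 4 < 4)%N by rewrite ltn_mod.
rewrite /dvdn -modnMm -[m.+1]addn1 -(modnDml m 1).
by case: (m %% 4)%N => [|[|[|[|]]]].
Qed.

Local Close Scope ring_scope.

Lemma modn_admissible3 (n : nat) : 2 %| 'C(n, 2) -> 6 %| 'C(n, 3) ->
  (n %% 36 \in [:: 0; 1; 9; 20; 28; 29])%N.
Proof.
rewrite dvdn_bin2; case: n => [|[|m]] //.
have binE : ('C(m.+2, 3) * 6 = m.+2 * m.+1 * m)%N.
  by have := bin_ffact m.+2 3; rewrite !ffactnSr ffactn0 (_ : 3`! = 6)%N //; lia.
rewrite -[(6 %| _)%N](@dvdn_pmul2r 6) // binE.
set r := (m %% 36)%N.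
have e0 : m = r %[mod 36] by rewrite modn_mod.
have e1 : m.+1 = r.+1 %[mod 36] by rewrite -(addn1 m) -(addn1 r) modnDml.
have e2 : m.+2 = r.+2 %[mod 36] by rewrite -(addn2 m) -(addn2 r) modnDml.
have modM x x' y y' : x = x' %[mod 36] -> y = y' %[mod 36] ->
    x * y = x' * y' %[mod 36].
  by move=> ex ey; rewrite -modnMm ex ey modnMm.
have -> : (36 %| m.+2 * m.+1 * m) = (36 %| r.+2 * r.+1 * r).
  by rewrite /dvdn; congr (_ == _); apply: (modM _ _ _ _ (modM _ _ _ _ e2 e1) e0).
rewrite -[m.+2 %% 4](@modn_dvdm 36) // e2.
have r_lt : r \in iota 0 36 by rewrite mem_iota ltn_mod.
pose ok r := (r.+2 %% 36 %% 4 \in [:: 0; 1]) ==> (36 %| r.+2 * r.+1 * r) ==>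
  (r.+2 %% 36 \in [:: 0; 1; 9; 20; 28; 29]).
have /allP/(_ _ r_lt)/implyP ok_r : all ok (iota 0 36) by vm_compute.
by move=> /ok_r/implyP.
Qed.

(** * The characterization *)

Theorem theorem1 (n k : nat) (hk : k \in [:: 1; 2; 3]) (hkn : k <= n) :
  (exists pi : 'S_n, balanced k pi) <->
  (forall r : nat, 1 <= r <= k -> r`! %| 'C(n, r)).
Proof.
split=> [[pi bal] r /andP[r_gt0]|dvd_bin].
  rewrite leq_eqVlt => /predU1P[->|lt_rk].
    by have /balancedP/(_ 1%g) <- := bal; apply: dvdn_mull.
  case: r r_gt0 lt_rk => [|[_ _|r _ lt_rk]] //.
  have {lt_rk} [k3 ->] : k = 3 /\ r = 0 by move: hk; rewrite !inE; lia.
  by rewrite k3 in hkn bal; exact: balanced3_even hkn bal.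
move: hk hkn dvd_bin; rewrite !inE => /or3P[] /eqP -> _ dvd_bin.
- by exists 1%g; apply: balanced1.
- have [|pi rot_pi] := @rotational_exists n; last first.
    by exists pi; apply: rotational_balanced2.
  by rewrite -dvdn_bin2; apply: (dvd_bin 2).
- apply: balanced3_exists; apply: modn_admissible3; first exact: (dvd_bin 2).
  exact: (dvd_bin 3).
Qed.
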